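(* Let $a<b$ be integers, $\mathbf{I}=\{a,\dots,b\}$, $\mathbf{I}^*=\{a+\tfrac12,\dots,b-\tfrac12\}$ and $\beta>0$. Let $V$ be the Ising transfer matrix at inverse temperature $\beta$, let $T_V:\mathcal{W}\to\mathcal{W}$, $T_V(w)=V\circ w\circ V^{-1}$, be its induced rotation on the space $\mathcal{W}$ of Clifford generators, and let $P_\beta^{\mathbb{C}}:(\mathbb{C}^2)^{\mathbf{I}^*}\to(\mathbb{C}^2)^{\mathbf{I}^*}$ be the complexification of the massive s-holomorphic propagator $P_\beta$. Then there exists a complex-linear isomorphism $\varrho:(\mathbb{C}^2)^{\mathbf{I}^*}\to\mathcal{W}$ such that $T_V=\varrho\circ P_\beta^{\mathbb{C}}\circ\varrho^{-1}$.
   Context: **Transfer matrix.** $\mathcal{S}$ is the complex vector space with basis $(\mathbf{e}_\sigma)_{\sigma\in\{\pm1\}^{\mathbf{I}}}$. $V=(V^{h})^{1/2}V^{v}(V^{h})^{1/2}$, where $V^v_{\sigma\rho}=\exp(\beta\sum_{i=a}^b\sigma_i\rho_i)$ if $\sigma_a=\rho_a$ and $\sigma_b=\rho_b$, and $V^v_{\sigma\rho}=0$ otherwise; $(V^h)^{1/2}$ is diagonal with entries $\exp(\frac{\beta}{2}\sum_{i=a}^{b-1}\sigma_i\sigma_{i+1})$. $V$ is invertible. **Clifford generators.** For $k\in\mathbf{I}^*$: $p_k(\mathbf{e}_\sigma)=\sigma_{k+1/2}\mathbf{e}_\tau$ and $q_k(\mathbf{e}_\sigma)=i\,\sigma_{k-1/2}\mathbf{e}_\tau$,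 where $\tau_x=\sigma_x$ for $x>k$ and $\tau_x=-\sigma_x$ for $x<k$. $\mathcal{W}=\mathrm{span}_{\mathbb{C}}\{p_k,q_k: k\in\mathbf{I}^*\}\subset\mathrm{End}(\mathcal{S})$; it is invariant under conjugation by $V$. **Massive s-holomorphicity.** Edges of the square lattice are identified with their midpoints in $\mathbb{C}$. Set $\lambda=e^{i\pi/4}$, $\alpha=e^{-2\beta}$, $\nu=\lambda^{-3}\frac{\alpha+i}{\alpha-i}$. A function $F$ on the edges is massive s-holomorphic (parameter $\beta$) on a face with center $c$ and edges $E=c+\frac12$, $N=c+\frac i2$, $W=c-\frac12$, $S=c-\frac i2$ if $F(N)+\nu^{-1}\lambda\overline{F(N)}=\nu^{-1}F(E)+\lambda\overline{F(E)}$, $F(N)+\nu\lambda^{-1}\overline{F(N)}=\nu F(W)+\lambda^{-1}\overline{F(W)}$, $F(S)+\nu\lambda^{3}\overline{F(S)}=\nu F(E)+\lambda^{3}\overline{F(E)}$, $F(S)+\nu^{-1}\lambda^{-3}\overline{F(S)}=\nu^{-1}F(W)+\lambda^{-3}\overline{F(W)}$. **Propagator.** Write $\mathbf{I}^*_y=\{k+iy:k\in\mathbf{I}^*\}$ and $\mathbf{I}_{1/2}=\{x+\frac i2:x\in\mathbf{I}\}$. Every $f:\mathbf{I}^*_0\to\mathbb{C}$ has a unique extension $h$ to $\mathbf{I}^*_0\cup\mathbf{I}_{1/2}\cup\mathbf{I}^*_1$ that is massive s-holomorphic on all faces $k+\frac i2$, $k\in\mathbf{I}^*$, and satisfies the Riemann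 boundary condition $h\parallel\tau_{cw}^{-1/2}$ on the two vertical boundary edges ($\tau_{cw}$ the clockwise unit tangent of the box), i.e. $h(a+\frac i2)\in\mathbb{R}\lambda^{-1}$ and $h(b+\frac i2)\in\mathbb{R}\lambda$. With $\mathbb{C}\cong\mathbb{R}^2$, $P_\beta:(\mathbb{R}^2)^{\mathbf{I}^*}\to(\mathbb{R}^2)^{\mathbf{I}^*}$ is the real-linear map $f\mapsto h|_{\mathbf{I}^*_1}$; $P_\beta^{\mathbb{C}}$ is its complex-linear extension to $(\mathbb{C}^2)^{\mathbf{I}^*}$. *)

(* Defs.v *)
From HB Require Import structures.
From mathcomp Require Import all_boot all_order all_algebra.
From mathcomp Require Import complex.
From mathcomp Require Import boolp classical_sets functions reals sequences exp trigo.

Set Implicit Arguments.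
Unset Strict Implicit.
Unset Printing Implicit Defensive.

Import Order.TTheory GRing.Theory Num.Theory.
Local Open Scope ring_scope.

(* I = {a, ..., b} is encoded as 'I_(width a b).+1, with i standing for a + i,
   and I* = {a + 1/2, ..., b - 1/2} as 'I_(width a b), with k standing for
   a + k + 1/2. *)
Definition width (a b : int) : nat := `|b - a|%N.

Definition lsite n (k : 'I_n) : 'I_n.+1 := widen_ord (leqnSn n) k. (* k - 1/2 *)
Definition rsite n (k : 'I_n) : 'I_n.+1 := lift ord0 k.            (* k + 1/2 *)

(* A spin configuration; true encodes the spin -1. *)
Notation config n := {ffun 'I_n.+1 -> bool}.

Section Ising.
Variable R : realType.

Definition spin n (s : config n) (i : 'I_n.+1) : R := (-1) ^+ s i.

Local Notation state n := {ffun config n -> (R[i])^o}.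

Definition basis_state n (s : config n) : state n :=
  [ffun r => (r == s)%:R : (R[i])^o].

(* Linear extension of e_s |-> F s; see op_of_basis. *)
Definition ext_basis n (F : config n -> state n) (v : state n) : state n :=
  \sum_s v s *: F s.

Fact ext_basis_is_linear n (F : config n -> state n) : linear (ext_basis F).
Proof.
move=> c u v; rewrite /ext_basis scaler_sumr -big_split /=.
by apply: eq_bigr => s _; rewrite !ffunE scalerDl scalerA.
Qed.

HB.instance Definition _ n (F : config n -> state n) :=
  GRing.isLinear.Build _ _ _ _ (ext_basis F) (ext_basis_is_linear F).

Definition op_of n (F : config n -> state n) : 'End(state n) :=
  linfun (ext_basis F).

Lemma op_of_basis n (F : config n -> state n) s : op_of F (basis_state s) = F s.
Proof.
rewrite lfunE /= /ext_basis (bigD1 s) //= ffunE eqxx scale1r.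
by rewrite big1 ?addr0 // => r /negPf rs; rewrite ffunE rs scale0r.
Qed.

Definition Vv_entry n (beta : R) (s r : config n) : R :=
  if (s ord0 == r ord0) && (s ord_max == r ord_max)
  then expR (beta * \sum_(i < n.+1) spin s i * spin r i) else 0.

Definition Vv n (beta : R) : 'End(state n) :=
  op_of (fun r => \sum_s (real_complex R (Vv_entry beta s r)) *: basis_state s).

Definition Vh_half n (beta : R) : 'End(state n) :=
  op_of (fun s =>
    real_complex R (expR (beta / 2 * \sum_(k < n) spin s (lsite k) * spin s (rsite k)))
      *: basis_state s).

Definition transfer n (beta : R) : 'End(state n) :=
  (Vh_half n beta \o Vv n beta \o Vh_half n beta)%VF.

(* k stands for a + k + 1/2, so the sites to its left are those with i <= k. *)
Definition flip_left n (k : 'I_n) (s : config n) : config n :=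
  [ffun i : 'I_n.+1 => if (i <= k)%N then ~~ s i else s i].

Definition gen_p n (k : 'I_n) : 'End(state n) :=
  op_of (fun s =>
    real_complex R (spin s (rsite k)) *: basis_state (flip_left k s)).

Definition gen_q n (k : 'I_n) : 'End(state n) :=
  op_of (fun s =>
    ('i%C * real_complex R (spin s (lsite k))) *: basis_state (flip_left k s)).

Definition clifford (n : nat) : {vspace 'End(state n)} :=
  <<[seq gen_p k | k : 'I_n] ++ [seq gen_q k | k : 'I_n]>>%VS.

(* The conjugation T_V.  Here it acts on all of End(S).  The inverse of 'End is only a true
   inverse on bijective maps, which the transfer matrix is for beta > 0. *)
Definition rotation n (V w : 'End(state n)) : 'End(state n) :=
  (V \o w \o V^-1)%VF.

Definition lam : R[i] := (cos (pi / 4) +i* sin (pi / 4))%C.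

Definition alpha (beta : R) : R := expR (- 2 * beta).

Definition nu (beta : R) : R[i] :=
  lam ^- 3 * ((real_complex R (alpha beta) + 'i%C) / (real_complex R (alpha beta) - 'i%C)).

(* An edge is identified with its midpoint, so that a function on edges is a
   function R[i] -> R[i] of which only the values at midpoints matter. *)
Definition massive_shol (beta : R) (F : R[i] -> R[i]) (c : R[i]) : Prop :=
  let E := c + 2^-1 in
  let N := c + 'i%C / 2 in
  let W := c - 2^-1 in
  let S := c - 'i%C / 2 in
  let v := nu beta in
  [/\ F N + v^-1 * lam * (F N)^*%C = v^-1 * F E + lam * (F E)^*%C,
      F N + v * lam^-1 * (F N)^*%C = v * F W + lam^-1 * (F W)^*%C,
      F S + v * lam ^+ 3 * (F S)^*%C = v * F E + lam ^+ 3 * (F E)^*%C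
    & F S + v^-1 * lam ^- 3 * (F S)^*%C = v^-1 * F W + lam ^- 3 * (F W)^*%C].

Definition site_pos (a : int) n (i : 'I_n.+1) : R := a%:~R + i%:R.
Definition dual_pos (a : int) n (k : 'I_n) : R := a%:~R + k%:R + 2^-1.

Definition real_line (u z : R[i]) : Prop := exists r : R, z = real_complex R r * u.

(* 'M[R]_(n, 2) is (R^2)^(I* ); row k of the matrix is the value at k. *)
Definition cval n (f : 'M[R]_(n, 2)) (k : 'I_n) : R[i] :=
  (f k ord0 +i* f k ord_max)%C.

Definition is_extension (a : int) n (beta : R) (f : 'M[R]_(n, 2))
    (h : R[i] -> R[i]) : Prop :=
  [/\ forall k : 'I_n, h (dual_pos a k +i* 0)%C = cval f k,
      forall k : 'I_n, massive_shol beta h (dual_pos a k +i* 2^-1)%C,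
      real_line lam^-1 (h (site_pos a (ord0 : 'I_n.+1) +i* 2^-1)%C)
    & real_line lam (h (site_pos a (ord_max : 'I_n.+1) +i* 2^-1)%C)].

(* For beta > 0 and n > 0 an extension h of f exists and is unique on the
   edges of the box, so that the set below is a singleton; the default value 0
   plays no role. *)
Definition propagator (a : int) n (beta : R) (f : 'M[R]_(n, 2)) : 'M[R]_(n, 2) :=
  xget 0 [set g : 'M[R]_(n, 2) | exists2 h : R[i] -> R[i],
    is_extension a beta f h &
    forall k : 'I_n, cval g k = h (dual_pos a k +i* 1)%C]%classic.

(* The C-linear extension of a real-linear map:
   X + iY is sent to P X + i P Y for real X and Y. *)
Definition complexify m n p q (P : 'M[R]_(m, n) -> 'M[R]_(p, q))
    (Z : 'M[R[i]]_(m, n)) : 'M[R[i]]_(p, q) :=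
  map_mx (real_complex R) (P (map_mx (@complex.Re R) Z))
  + 'i%C *: map_mx (real_complex R) (P (map_mx (@complex.Im R) Z)).

End Ising.

(* Main.v *)
(* Put X_k = p_k - i q_k and Y_k = p_k + i q_k, and let rho send the real
   coordinates (x, y) of the value at k to x X_k + y Y_k.  Conjugation by
   (V^h)^(1/2) multiplies X_k by exp(-beta) and Y_k by exp(beta), while
   conjugation by V^v only mixes p_(k-1) and q_k, the two generators attached
   to the site k: with alpha = exp(-2 beta) it sends
     (u + alpha v) p_(k-1) + i (alpha u + v) q_k  to
     (u - alpha v) p_(k-1) + i (v - alpha u) q_k
   at interior sites, and it fixes the first q and the last p.
   On the other side, let u + i v be lam^-1 times the value of an s-holomorphic
   function at a site of the half row.  The four relations on a face become
   real and linear: they express alpha x + y and y - alpha x below, and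
   x + alpha y and x - alpha y above, by exactly these combinations of u and v,
   and the Riemann condition says u = 0 on the left and v = 0 on the right.
   Hence V rho(f) = rho(P f) V.  The transfer matrix is invertible since V^v is
   a tensor product of invertible 2x2 matrices (up to the boundary spins). *)

From HB Require Import structures.
Require Import Defs.
From mathcomp Require Import all_boot all_order all_algebra.
From mathcomp Require Import complex.
From mathcomp Require Import boolp classical_sets functions reals sequences exp trigo.
From mathcomp Require Import ring lra.

Set Implicit Arguments.
Unset Strict Implicit.
Unset Printing Implicit Defensive.

Import Order.TTheory GRing.Theory Num.Theory.
Local Open Scope ring_scope.

(** * Operators on spin configurations as matrices *)

Section Entries.
Variables (C : fieldType) (T : finType).
Local Notation state := {ffun T -> C^o}.
Implicit Types (f g : 'End(state)) (s t : T).

(** Stated over a general field and index type; on configurations it is convertible to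
    [basis_state]. *)
Definition ket s : state := [ffun r => (r == s)%:R].

(* Row t, column s. *)
Definition entry f s t : C := f (ket s) t.

Lemma ketE s t : ket s t = (t == s)%:R :> C.
Proof. by rewrite ffunE. Qed.

Lemma state_decomp (v : state) : v = \sum_s v s *: ket s.
Proof.
apply/ffunP => s; rewrite sum_ffunE (bigD1 s) // big1 => [|r /negPf rs].
  by rewrite 2!ffunE eqxx; rewrite [RHS]addr0; exact/esym/mulr1.
by rewrite 2!ffunE eq_sym rs; exact: mulr0.
Qed.

Lemma entryP f g : (forall s t, entry f s t = entry g s t) -> f = g.
Proof.
move=> fg; apply/lfunP => v; rewrite [v]state_decomp !linear_sum /=.
by apply: eq_bigr => s _; rewrite !linearZ /=; congr (_ *: _); apply/ffunP => t; exact: fg.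
Qed.

Lemma entryD f g s t : entry (f + g) s t = entry f s t + entry g s t.
Proof. by rewrite /entry add_lfunE ffunE. Qed.

Lemma entryZ c f s t : entry (c *: f) s t = c * entry f s t.
Proof. by rewrite /entry scale_lfunE ffunE. Qed.

Lemma entry_comp f g s t : entry (f \o g)%VF s t = \sum_r entry g s r * entry f r t.
Proof.
rewrite /entry comp_lfunE [X in f X]state_decomp linear_sum sum_ffunE.
by apply: eq_bigr => r _; rewrite linearZ ffunE.
Qed.

Lemma entry_id s t : entry \1 s t = (t == s)%:R.
Proof. by rewrite /entry id_lfunE ketE. Qed.

Lemma entry_sum (I : finType) (F : I -> 'End(state)) s t :
  entry (\sum_i F i) s t = \sum_i entry (F i) s t.
Proof. by rewrite /entry sum_lfunE sum_ffunE. Qed.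

End Entries.

Lemma mulii (R : realType) : 'i%C * 'i%C = -1 :> R[i].
Proof. by rewrite -expr2 sqr_i. Qed.

Section ConcreteEntries.
Variables (R : realType) (n : nat).
Implicit Types (s t : config n) (k : 'I_n).

Lemma entry_op_of (F : config n -> {ffun config n -> (R[i])^o}) s t : entry (op_of F) s t = F s t.
Proof. by rewrite /entry op_of_basis. Qed.

Lemma entry_p k s t :
  entry (gen_p R k) s t = (spin R s (rsite k))%:C%C * (t == flip_left k s)%:R.
Proof. by rewrite entry_op_of 2!ffunE. Qed.

Lemma entry_q k s t :
  entry (gen_q R k) s t = 'i%C * (spin R s (lsite k))%:C%C * (t == flip_left k s)%:R.
Proof. by rewrite entry_op_of 2!ffunE. Qed.

Definition Vh_weight beta s : R :=
  expR (beta / 2 * \sum_(k < n) spin R s (lsite k) * spin R s (rsite k)).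

Lemma entry_Vh beta s t :
  entry (Vh_half n beta) s t = (Vh_weight beta s)%:C%C * (t == s)%:R.
Proof. by rewrite entry_op_of 2!ffunE. Qed.

Lemma entry_Vv (beta : R) s t : entry (Vv n beta) s t = (Vv_entry beta t s)%:C%C.
Proof.
rewrite entry_op_of sum_ffunE (bigD1 t) // big1 => [|r /negPf rs].
  by rewrite 2!ffunE eqxx; rewrite [LHS]addr0; exact/mulr1.
by rewrite 2!ffunE eq_sym rs; exact: mulr0.
Qed.
End ConcreteEntries.

Section Intertwining.
Variables (C : fieldType) (vT : vectType C).
Implicit Types f g w : 'End(vT).

(** The relation [f w f^-1 = w'] freed of the inverse: in this form it adds, scales and composes,
    and invertibility of [f] enters once, in [lker0_conj]. *)
Definition intertwines f w w' := (f \o w)%VF = (w' \o f)%VF.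

Lemma intertwinesD f w1 w1' w2 w2' :
  intertwines f w1 w1' -> intertwines f w2 w2' -> intertwines f (w1 + w2) (w1' + w2').
Proof. by rewrite /intertwines comp_lfunDr comp_lfunDl => -> ->. Qed.

Lemma intertwinesZ f w w' c : intertwines f w w' -> intertwines f (c *: w) (c *: w').
Proof. by rewrite /intertwines -comp_lfunZr -comp_lfunZl => ->. Qed.

Lemma intertwines_sum f n (F F' : 'I_n -> 'End(vT)) :
  (forall k, intertwines f (F k) (F' k)) -> intertwines f (\sum_k F k) (\sum_k F' k).
Proof.
move=> FF'; elim/big_ind2: _ => // [|w1 w1' w2 w2']; last exact: intertwinesD.
by rewrite /intertwines comp_lfun0r comp_lfun0l.
Qed.

Lemma intertwines_comp f g w1 w2 w3 :
  intertwines g w1 w2 -> intertwines f w2 w3 -> intertwines (f \o g)%VF w1 w3.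
Proof.
by rewrite /intertwines => gw fw; rewrite -comp_lfunA gw !comp_lfunA fw.
Qed.

End Intertwining.

Section Monomial.
Variables (C : fieldType) (T : finType).
Implicit Types (f g : 'End({ffun T -> C^o})) (phi psi : T -> T) (c d : T -> C).

Lemma entry_comb f g x y z s t : entry f s t = x -> entry g s t = y ->
  entry (f + z *: g) s t = x + z * y.
Proof. by move=> <- <-; rewrite entryD entryZ. Qed.

Lemma entry_comp_combr f g h x y z w s t :
  entry (f \o g)%VF s t = x -> entry (f \o h)%VF s t = y ->
  entry (f \o (z *: g + w *: h))%VF s t = z * x + w * y.
Proof. by move=> <- <-; rewrite comp_lfunDr -!comp_lfunZr entryD !entryZ. Qed.

Lemma entry_comp_combl f g h x y z w s t :
  entry (g \o f)%VF s t = x -> entry (h \o f)%VF s t = y ->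
  entry ((z *: g + w *: h) \o f)%VF s t = z * x + w * y.
Proof. by move=> <- <-; rewrite comp_lfunDl -!comp_lfunZl entryD !entryZ. Qed.

(** At most one nonzero entry per column. The generators, [lo], [hi] and the diagonal [Vh_half] all
    have this shape, so identities between their products reduce to scalar identities in [s]. *)
Definition monomial f phi c := forall s t, entry f s t = c s * (t == phi s)%:R.

Lemma entry_comp_monomial_r f g phi c s t : monomial g phi c ->
  entry (f \o g)%VF s t = c s * entry f (phi s) t.
Proof.
move=> gE; rewrite entry_comp (bigD1 (phi s)) // big1 => [|r /negPf rs].
  by rewrite /= gE eqxx mulr1 addr0.
by rewrite gE rs mulr0 mul0r.
Qed.

(** The only intermediate index that contributes is the preimage of [t] under [phi], which is
    [phi t] for an involution. *)
Lemma entry_comp_monomial_l f g phi c s t : involutive phi -> monomial f phi c ->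
  entry (f \o g)%VF s t = c (phi t) * entry g s (phi t).
Proof.
move=> phiK fE; rewrite entry_comp (bigD1 (phi t)) // big1 => [|r rs].
  by rewrite /= fE phiK eqxx mulr1 addr0 mulrC.
by rewrite fE eq_sym (inv_eq phiK) (negPf rs) !mulr0.
Qed.

Lemma monomial_comp f g phi psi c d : monomial f phi c -> monomial g psi d ->
  monomial (f \o g)%VF (phi \o psi) (fun s => d s * c (psi s)).
Proof. by move=> fE gE s t; rewrite (entry_comp_monomial_r _ _ _ gE) fE mulrA. Qed.

Lemma monomialZ f phi c z : monomial f phi c -> monomial (z *: f) phi (fun s => z * c s).
Proof. by move=> fE s t; rewrite entryZ fE mulrA. Qed.

Lemma eq_monomial f g phi c d :
  monomial f phi c -> monomial g phi d -> c =1 d -> f = g.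
Proof. by move=> fE gE cd; apply: entryP => s t; rewrite fE gE cd. Qed.

End Monomial.

(** * Conjugation of the Clifford generators *)

Section Relations.
Variables (R : realType) (n : nat).
Implicit Types (s r t : config n) (k l : 'I_n) (i : 'I_n.+1).

Lemma flip_leftK k : involutive (flip_left k).
Proof. by move=> s; apply/ffunP => i; rewrite !ffunE; case: (i <= k)%N => //; rewrite negbK. Qed.

Lemma spin_flip_lt k s i : (k < i)%N -> spin R (flip_left k s) i = spin R s i.
Proof. by rewrite /spin ffunE ltnNge => /negPf ->. Qed.

Lemma spin_flip_le k s i : (i <= k)%N -> spin R (flip_left k s) i = - spin R s i.
Proof. by rewrite /spin ffunE => ->; case: (s i); rewrite ?expr1 ?expr0 ?opprK. Qed.

Lemma spin_flip_rsite k s : spin R (flip_left k s) (rsite k) = spin R s (rsite k).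
Proof. exact: spin_flip_lt. Qed.

Lemma spin_flip_lsite k s : spin R (flip_left k s) (lsite k) = - spin R s (lsite k).
Proof. exact: spin_flip_le. Qed.

Variant spin_spec : R -> Prop :=
  SpinUp : spin_spec 1 | SpinDown : spin_spec (- 1).

Lemma spinP s i : spin_spec (spin R s i).
Proof. by rewrite /spin; case: (s i); constructor. Qed.

Lemma spin_flipM k s t i :
  spin R (flip_left k s) i * spin R t i = spin R s i * spin R (flip_left k t) i.
Proof.
by case: (leqP i k) => ik; [rewrite !spin_flip_le // mulrN mulNr | rewrite !spin_flip_lt].
Qed.

(** Only the bond across [k] changes sign: every other bond has both of its sites flipped or
    neither. *)
Lemma Vh_weight_flip (beta : R) k s : Vh_weight beta (flip_left k s) =
  expR (- beta * (spin R s (lsite k) * spin R s (rsite k))) * Vh_weight beta s.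
Proof.
rewrite /Vh_weight -expRD; congr expR.
rewrite (bigD1 k) //= [in RHS](bigD1 k) //= spin_flip_lsite spin_flip_rsite.
set S1 := \sum_(_ < _ | _) _; set S2 := \sum_(_ < _ | _) _.
have -> : S1 = S2.
  apply: eq_bigr => l; rewrite -val_eqE /= neq_ltn => /orP[lk|kl].
    by rewrite !spin_flip_le ?mulrNN //= ?(ltnW lk).
  by rewrite !spin_flip_lt //= ?(leqW kl).
by field.
Qed.

Definition lo k : 'End(_) := gen_p R k + (- 'i%C) *: gen_q R k.
Definition hi k : 'End(_) := gen_p R k + 'i%C *: gen_q R k.

Lemma monomial_lo k : monomial (lo k) (flip_left k)
  (fun s => (spin R s (rsite k) + spin R s (lsite k))%:C%C).
Proof.
move=> s t; rewrite (entry_comb _ (entry_p R k s t) (entry_q R k s t)).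
by rewrite !mulrA mulNr mulii opprK mul1r -mulrDl rmorphD.
Qed.

Lemma monomial_hi k : monomial (hi k) (flip_left k)
  (fun s => (spin R s (rsite k) - spin R s (lsite k))%:C%C).
Proof.
move=> s t; rewrite (entry_comb _ (entry_p R k s t) (entry_q R k s t)).
by rewrite !mulrA mulii mulN1r -mulrDl rmorphB.
Qed.

(** The coefficient of [lo k] vanishes unless the two spins next to [k] agree, and then
    [Vh_weight_flip] contributes exp(-beta). For [hi k] the spins must differ, which gives
    exp(beta). *)
Lemma Vh_half_lo (beta : R) k :
  intertwines (Vh_half n beta) (lo k) ((expR (- beta))%:C%C *: lo k).
Proof.
apply: (eq_monomial (monomial_comp (entry_Vh beta) (monomial_lo k))
  (monomial_comp (monomialZ _ (monomial_lo k)) (entry_Vh beta))) => s /=.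
rewrite -!rmorphM Vh_weight_flip; congr (_%:C%C).
by case: spinP; case: spinP; rewrite ?mulrNN ?mulr1 ?addrN ?addNr; ring.
Qed.

Lemma Vh_half_hi (beta : R) k :
  intertwines (Vh_half n beta) (hi k) ((expR beta)%:C%C *: hi k).
Proof.
apply: (eq_monomial (monomial_comp (entry_Vh beta) (monomial_hi k))
  (monomial_comp (monomialZ _ (monomial_hi k)) (entry_Vh beta))) => s /=.
rewrite -!rmorphM Vh_weight_flip; congr (_%:C%C).
by case: spinP; case: spinP; rewrite ?mulrNN !(mul1r, mulrN1, mulr1, opprK); ring.
Qed.

Lemma Vh_half_invl (beta : R) : (Vh_half n (- beta) \o Vh_half n beta)%VF = \1%VF.
Proof.
apply: entryP => s t; rewrite entry_id.
rewrite (monomial_comp (entry_Vh (- beta)) (entry_Vh beta) s t) /=.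
by rewrite -rmorphM /= /Vh_weight -expRD !mulNr subrr expR0 mul1r.
Qed.

(** V^v sees the two rows only through the products of their spins and their agreement at the ends,
    so a flip can be moved from one row to the other. *)
Lemma Vv_entry_flip (beta : R) k t s :
  Vv_entry beta (flip_left k t) s = Vv_entry beta t (flip_left k s).
Proof.
have flip_eq i : (flip_left k t i == s i) = (t i == flip_left k s i).
  by rewrite !ffunE; case: ifP => _ //; case: (t i); case: (s i).
rewrite /Vv_entry !flip_eq; case: ifP => // _; congr (expR (_ * _)).
by apply: eq_bigr => i _; exact: spin_flipM.
Qed.

Lemma flip_left_ord0 k s : flip_left k s ord0 = ~~ s ord0.
Proof. by rewrite ffunE. Qed.

Lemma flip_left_ord_max k s : flip_left k s ord_max = s ord_max.
Proof. by rewrite ffunE /= leqNgt ltn_ord. Qed.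

(** The two flips differ only at the site between [k] and [l], which is not an endpoint. The
    boundary constraint is therefore the same on both sides, and one term of the exponent changes
    sign. *)
Lemma Vv_entry_flip_succ (beta : R) k l t s : k.+1 = l :> nat ->
  Vv_entry beta t (flip_left l s) =
  expR (- 2 * beta * (spin R t (rsite k) * spin R s (rsite k))) * Vv_entry beta t (flip_left k s).
Proof.
move=> kl; rewrite /Vv_entry !flip_left_ord0 !flip_left_ord_max.
case: ifP => _; last by rewrite mulr0.
rewrite -expRD; congr expR.
rewrite (bigD1 (rsite k)) //= [in RHS](bigD1 (rsite k)) //=.
rewrite spin_flip_rsite spin_flip_le; last by rewrite /= -kl.
set S1 := \sum_(_ < _ | _) _; set S2 := \sum_(_ < _ | _) _.
have -> : S1 = S2.
  apply: eq_bigr => i; rewrite -val_eqE /= neq_ltn => /orP[ik|ki]; congr (_ * _).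
    by rewrite !spin_flip_le // -kl ltnW.
  by rewrite !spin_flip_lt // -?kl // ltnW.
by ring.
Qed.

Lemma entry_Vv_p (beta : R) k s t : entry (Vv n beta \o gen_p R k)%VF s t =
  (spin R s (rsite k) * Vv_entry beta t (flip_left k s))%:C%C.
Proof.
by rewrite (entry_comp_monomial_r _ _ _ (entry_p R k)) entry_Vv rmorphM.
Qed.

Lemma entry_p_Vv (beta : R) k s t : entry (gen_p R k \o Vv n beta)%VF s t =
  (spin R t (rsite k) * Vv_entry beta t (flip_left k s))%:C%C.
Proof.
rewrite (entry_comp_monomial_l _ _ _ (@flip_leftK k) (entry_p R k)) entry_Vv.
by rewrite Vv_entry_flip spin_flip_rsite rmorphM.
Qed.

Lemma entry_Vv_q (beta : R) k s t : entry (Vv n beta \o gen_q R k)%VF s t =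
  'i%C * (spin R s (lsite k) * Vv_entry beta t (flip_left k s))%:C%C.
Proof.
by rewrite (entry_comp_monomial_r _ _ _ (entry_q R k)) entry_Vv rmorphM mulrA.
Qed.

Lemma entry_q_Vv (beta : R) k s t : entry (gen_q R k \o Vv n beta)%VF s t =
  - ('i%C * (spin R t (lsite k) * Vv_entry beta t (flip_left k s))%:C%C).
Proof.
rewrite (entry_comp_monomial_l _ _ _ (@flip_leftK k) (entry_q R k)) entry_Vv.
by rewrite Vv_entry_flip spin_flip_lsite rmorphN mulrN mulNr rmorphM mulrA.
Qed.

(** Compared entry by entry, both sides are multiples of one entry of V^v. Where the two rows agree
    at the shared site only the [u] part survives, where they differ only the [v] part. *)
Lemma Vv_interior (beta : R) k l (u v : R[i]) : k.+1 = l :> nat ->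
  let a := (alpha beta)%:C%C in
  intertwines (Vv n beta)
    ((u + a * v) *: gen_p R k + ('i%C * (a * u + v)) *: gen_q R l)
    ((u - a * v) *: gen_p R k + ('i%C * (v - a * u)) *: gen_q R l).
Proof.
move=> kl a; apply: entryP => s t.
rewrite (entry_comp_combr _ _ (entry_Vv_p beta k s t) (entry_Vv_q beta l s t)).
rewrite (entry_comp_combl _ _ (entry_p_Vv beta k s t) (entry_q_Vv beta l s t)).
have <- : rsite k = lsite l by apply/val_inj; rewrite /= -kl.
rewrite (Vv_entry_flip_succ beta t s kl).
set K := Vv_entry _ _ _.
have II (x y : R[i]) : ('i%C * x) * ('i%C * y) = - (x * y) by rewrite mulrACA mulii mulN1r.
rewrite mulrN !II; case: (spinP s); case: (spinP t).
- rewrite !mul1r mulr1 -/(alpha beta) rmorphM -/a; ring.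
- rewrite mulr1 mulrN1 mulNr opprK !mulN1r !mul1r !rmorphN /=.
  (* For opposite spins the factor is exp(2 beta), the inverse of alpha; pulling alpha out of [K]
     leaves a polynomial identity. *)
  have -> : K%:C%C = a * (expR (2 * beta) * K)%:C%C.
    by rewrite -rmorphM mulrA /alpha -expRD mulNr addNr expR0 mul1r.
  by ring.
- rewrite mul1r mulrN1 mulNr opprK !mulN1r !mul1r !rmorphN /=.
  have -> : K%:C%C = a * (expR (2 * beta) * K)%:C%C.
    by rewrite -rmorphM mulrA /alpha -expRD mulNr addNr expR0 mul1r.
  by ring.
- rewrite mulrNN !mulr1 -/(alpha beta) !mulN1r !rmorphN rmorphM -/a; ring.
Qed.

(** The last [p] reads the spin at the right end, which its flip leaves alone and V^v preserves. *)
Lemma Vv_last (beta : R) k : k.+1 = n ->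
  intertwines (Vv n beta) (gen_p R k) (gen_p R k).
Proof.
move=> kn; apply: entryP => s t.
apply: etrans (entry_Vv_p _ _ _ _) (etrans _ (esym (entry_p_Vv _ _ _ _))).
have -> : rsite k = ord_max by apply/val_inj.
rewrite /Vv_entry flip_left_ord_max /spin.
by case: ifP => [/andP[_ /eqP ->] | _] //; rewrite !mulr0.
Qed.

(** The first [q] reads the left end spin, which its own flip reverses; this sign cancels the one
    from moving [q] across V^v. *)
Lemma Vv_first (beta : R) k : k = 0 :> nat ->
  intertwines (Vv n beta) (gen_q R k) (gen_q R k).
Proof.
move=> k0; apply: entryP => s t.
apply: etrans (entry_Vv_q _ _ _ _) (etrans _ (esym (entry_q_Vv _ _ _ _))).
have -> : lsite k = ord0 by apply/val_inj.
rewrite /Vv_entry flip_left_ord0 /spin -mulrN -rmorphN -mulNr; congr (_ * _%:C%C).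
case: ifP => [/andP[/eqP -> _] | _]; last by rewrite !mulr0.
by case: (s ord0); rewrite ?expr1 ?expr0 ?opprK.
Qed.

End Relations.

(** * Invertibility of the transfer matrix *)

Section Inverse.
Variables (C : fieldType) (vT : vectType C).
Implicit Types f g w : 'End(vT).

Lemma lker0_invl f g : (g \o f)%VF = \1%VF -> lker f == 0%VS.
Proof.
move=> gf; apply/lker0P => x y fxy.
by rewrite -[x](id_lfunE (aT:=vT)) -[y](id_lfunE (aT:=vT)) -gf !comp_lfunE fxy.
Qed.

Lemma lker0_comp f g : lker f == 0%VS -> lker g == 0%VS -> lker (f \o g)%VF == 0%VS.
Proof.
move=> /lker0P f0 /lker0P g0; apply/lker0P => x y.
by rewrite !comp_lfunE => /f0 /g0.
Qed.

Lemma lker0_conj f w w' : lker f == 0%VS -> intertwines f w w' ->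
  (f \o w \o f^-1)%VF = w'.
Proof. by move=> f0 ->; rewrite -comp_lfunA lker0_compfV // comp_lfun1r. Qed.

End Inverse.

Section TransferInverse.
Variables (R : realType) (n : nat) (beta : R).
Hypothesis beta_gt0 : 0 < beta.
Implicit Types (s r t : config n) (i : 'I_n.+1).

Definition endpoint i := (i == ord0) || (i == ord_max).

Definition Vv_factor i (x y : bool) : R :=
  if endpoint i then expR beta * (x == y)%:R else expR (beta * ((-1) ^+ x * (-1) ^+ y)).

(** The inverse of the one-site block: at interior sites the adjugate divided by the determinant
    exp(2 beta) - exp(-2 beta). *)
Definition Vv_factor_inv i (x y : bool) : R :=
  if endpoint i then expR (- beta) * (x == y)%:R
  else (if x == y then expR beta else - expR (- beta)) / (expR (2 * beta) - expR (- 2 * beta)).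

Lemma Vv_entry_prod s r : Vv_entry beta s r = \prod_i Vv_factor i (s i) (r i).
Proof.
rewrite /Vv_entry; case: ifP => [/andP[s0 s1]|].
  rewrite mulr_sumr expR_sum; apply: eq_bigr => i _; rewrite /Vv_factor /spin.
  case: ifP => // /orP[] /eqP ->.
    by rewrite s0 (eqP s0) -expr2 sqrr_sign !mulr1.
  by rewrite s1 (eqP s1) -expr2 sqrr_sign !mulr1.
move=> /negbT; rewrite negb_and => /orP[] /negPf sr.
  by rewrite (bigD1 ord0) //= /Vv_factor /endpoint eqxx sr mulr0 mul0r.
by rewrite (bigD1 ord_max) //= /Vv_factor /endpoint eqxx orbT sr mulr0 mul0r.
Qed.

Lemma Vv_factorV i x z :
  \sum_(y : bool) Vv_factor i y x * Vv_factor_inv i z y = (z == x)%:R.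
Proof.
rewrite big_bool /Vv_factor /Vv_factor_inv.
case: ifP => _.
  have e1 : expR beta * expR (- beta) = 1 by rewrite -expRD addrN expR0.
  by case: x; case: z => /=; rewrite ?(mulr0, mul0r, mulr1, addr0, add0r).
(* Positivity of [beta] makes the determinant nonzero. *)
have D0 : expR (2 * beta) - expR (- 2 * beta) != 0.
  by rewrite subr_eq0 gt_eqF // ltr_expR; move: beta_gt0; lra.
have e2 : expR (2 * beta) = expR beta * expR beta by rewrite -expRD; congr expR; ring.
have e3 : expR (- 2 * beta) = expR (- beta) * expR (- beta) by rewrite -expRD; congr expR; ring.
move: D0; rewrite e2 e3.
by case: x; case: z => /= D0; rewrite ?expr1 ?expr0 !(mulrNN, mulr1, mul1r, mulrN1); field.
Qed.

Lemma Vv_invl : exists U, (U \o Vv n beta)%VF = \1%VF.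
Proof.
exists (op_of (fun s : config n =>
  [ffun t : config n => (\prod_i Vv_factor_inv i (t i) (s i))%:C%C])).
apply: entryP => s t; rewrite entry_comp entry_id.
rewrite (eq_bigr (fun r : config n =>
  (\prod_i (Vv_factor i (r i) (s i) * Vv_factor_inv i (t i) (r i)))%:C%C)); last first.
  by move=> r _; rewrite entry_Vv entry_op_of ffunE Vv_entry_prod big_split rmorphM.
(* The sum over configurations of a product over sites becomes a product of two-term sums, each
   treated by [Vv_factorV]. *)
rewrite -rmorph_sum -(bigA_distr_bigA (fun i y => Vv_factor i y (s i) * Vv_factor_inv i (t i) y)).
rewrite (eq_bigr (fun i => (t i == s i)%:R)) => [|i _]; last exact: Vv_factorV.
case: eqVneq => [-> | ts].
  by rewrite big1 // => i _; rewrite eqxx.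
have [i tsi] : exists i, t i != s i.
  apply/existsP; apply: contraNT ts => /existsPn ts; apply/eqP/ffunP => i.
  by apply/eqP; rewrite -[_ == _]negbK ts.
by rewrite (bigD1 i) //= (negPf tsi) mul0r.
Qed.

Lemma transfer_lker0 : lker (transfer n beta) == 0%VS.
Proof.
have [U UV] := Vv_invl.
apply: lker0_comp; last exact: lker0_invl (Vh_half_invl n beta).
by apply: lker0_comp; [exact: lker0_invl (Vh_half_invl n beta) | exact: lker0_invl UV].
Qed.

End TransferInverse.

(** * From single sites to conjugation by V *)

Lemma sum_shift (U : zmodType) m (F G : 'I_m.+1 -> U) :
  \sum_k (F k + G k) =
  \sum_(k < m) (F (widen_ord (leqnSn m) k) + G (lift ord0 k)) + (F ord_max + G ord0).
Proof.
rewrite !big_split big_ord_recr [X in _ + X = _]big_ord_recl.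
by rewrite -[RHS]addrACA; congr (_ + _); exact: addrC.
Qed.

Section LoHiCombinations.
Variables (C : fieldType) (vT : vectType C) (n : nat).
Variables (p q : 'I_n -> 'End(vT)) (H : 'End(vT)) (I d e : C).
Hypothesis H_lo : forall k, intertwines H (p k + (- I) *: q k) (d *: (p k + (- I) *: q k)).
Hypothesis H_hi : forall k, intertwines H (p k + I *: q k) (e *: (p k + I *: q k)).
Implicit Types x y : 'I_n -> C.

Definition lohi_comb x y : 'End(vT) :=
  \sum_k (x k *: (p k + (- I) *: q k) + y k *: (p k + I *: q k)).

Lemma lohi_combE x y :
  lohi_comb x y = \sum_k ((x k + y k) *: p k + (I * (y k - x k)) *: q k).
Proof.
apply: eq_bigr => k _; rewrite !scalerDr !scalerA addrACA -!scalerDl.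
by congr (_ + _ *: _); ring.
Qed.

(** Inverts the change of basis from (X_k, Y_k) to (p_k, q_k); it serves to show that [rho_op]
    reaches every generator. *)
Lemma lohi_comb_single k c c' : I * I = -1 -> 2 != 0 :> C ->
  lohi_comb (fun l => if l == k then (c + I * c') / 2 else 0)
            (fun l => if l == k then (c - I * c') / 2 else 0) = c *: p k + c' *: q k.
Proof.
move=> II two_neq0; rewrite lohi_combE (bigD1 k) // big1 => [|l /negPf lk].
  rewrite eqxx; apply: etrans (addr0 _) _; congr (_ *: _ + _ *: _); first by field.
  transitivity (- (I * I) * c'); first by field.
  by rewrite II opprK mul1r.
by rewrite lk subrr mulr0 addr0 !scale0r addr0.
Qed.

Lemma lohi_comb_linear c x y x' y' :
  lohi_comb (fun k => c * x k + x' k) (fun k => c * y k + y' k) =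
  c *: lohi_comb x y + lohi_comb x' y'.
Proof.
rewrite /lohi_comb scaler_sumr -big_split; apply: eq_bigr => k _ /=.
move: (p k + _) (p k + _) => lo hi.
by rewrite !scalerDl scalerDr !scalerA addrACA.
Qed.

Lemma intertwines_lohi x y :
  intertwines H (lohi_comb x y) (lohi_comb (fun k => x k * d) (fun k => y k * e)).
Proof.
apply: intertwines_sum => k; rewrite -!scalerA.
by apply: intertwinesD; apply: intertwinesZ; [exact: H_lo | exact: H_hi].
Qed.

End LoHiCombinations.

Section Conjugation.
Variables (C : fieldType) (vT : vectType C) (m : nat).
Variables (p q : 'I_m.+1 -> 'End(vT)) (V H : 'End(vT)) (I a d e : C).
Hypothesis ed : e * d = 1.
Hypothesis add : a = d * d.
Hypothesis H_lo : forall k, intertwines H (p k + (- I) *: q k) (d *: (p k + (- I) *: q k)).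
Hypothesis H_hi : forall k, intertwines H (p k + I *: q k) (e *: (p k + I *: q k)).
Hypothesis V_interior : forall (k l : 'I_m.+1) (u v : C), k.+1 = l :> nat ->
  intertwines V ((u + a * v) *: p k + (I * (a * u + v)) *: q l)
                ((u - a * v) *: p k + (I * (v - a * u)) *: q l).
Hypothesis V_last : intertwines V (p ord_max) (p ord_max).
Hypothesis V_first : intertwines V (q ord0) (q ord0).
Local Notation comb := (lohi_comb p q I).

(** By [sum_shift] each interior site collects the [p] on its left and the [q] on its right, and
    [V_interior] applies. At the ends, [u = 0] on the left and [v = 0] on the right make the
    coefficients of the first [q] and the last [p] the same before and after. *)
Lemma intertwines_site (u v : 'I_m.+2 -> C) : u ord0 = 0 -> v ord_max = 0 ->
  intertwines V
    (\sum_k ((u (rsite k) + a * v (rsite k)) *: p k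
             + (I * (a * u (lsite k) + v (lsite k))) *: q k))
    (\sum_k ((u (rsite k) - a * v (rsite k)) *: p k
             + (I * (v (lsite k) - a * u (lsite k))) *: q k)).
Proof.
move=> u0 v1; rewrite !sum_shift; apply: intertwinesD.
  apply: intertwines_sum => k.
  have -> : lsite (lift ord0 k) = rsite (widen_ord (leqnSn m) k) by apply/val_inj.
  exact: V_interior.
have -> : rsite (ord_max : 'I_m.+1) = ord_max by apply/val_inj.
have -> : lsite (ord0 : 'I_m.+1) = ord0 by apply/val_inj.
rewrite u0 v1 !mulr0 !addr0 add0r !subr0.
by apply: intertwinesD; apply: intertwinesZ.
Qed.

Lemma intertwines_transfer (x y x' y' : 'I_m.+1 -> C) (u v : 'I_m.+2 -> C) :
  u ord0 = 0 -> v ord_max = 0 ->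
  (forall k, [/\ a * x k + y k = u (rsite k) + a * v (rsite k),
                 y k - a * x k = a * u (lsite k) + v (lsite k),
                 x' k + a * y' k = u (rsite k) - a * v (rsite k)
               & x' k - a * y' k = a * u (lsite k) - v (lsite k)]) ->
  intertwines (H \o V \o H)%VF (comb x y) (comb x' y').
Proof.
move=> u0 v1 rel; have ea : e * a = d by rewrite add mulrA ed mul1r.
apply: intertwines_comp (intertwines_lohi H_lo H_hi x y) _.
(* The middle element is chosen for the last half step: [H] multiplies its coefficients by [d] and
   [e], which are mutually inverse, and so yields [x'] and [y']. *)
apply: (@intertwines_comp _ _ _ _ _ (comb (fun k => e * x' k) (fun k => d * y' k))); last first.
  have := intertwines_lohi H_lo H_hi (fun k => e * x' k) (fun k => d * y' k).
  congr (intertwines _ _ _); apply: eq_bigr => k _; congr (_ *: _ + _ *: _).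
    by rewrite mulrAC ed mul1r.
  by rewrite mulrAC [d * e]mulrC ed mul1r.
(* Since [d = e * a], a common factor [e] comes out of all coefficients in the basis p, q; what
   remains is the left sides of [rel], up to sign in the last. *)
have := intertwinesZ e (intertwines_site u0 v1).
rewrite !scaler_sumr !lohi_combE; congr (intertwines _ _ _); apply: eq_bigr => k _;
  rewrite scalerDr !scalerA; have [r1 r2 r3 r4] := rel k; congr (_ *: _ + _ *: _).
- by rewrite -r1 -ea; ring.
- by rewrite -r2 -ea; ring.
- by rewrite -r3 -ea; ring.
- have -> : v (lsite k) - a * u (lsite k) = - (x' k - a * y' k) by rewrite r4 opprB.
  by rewrite -ea; ring.
Qed.

End Conjugation.

(** * The propagator in real coordinates *)

Section Propagator.
Variable R : realType.
Implicit Types (x y : R) (z w : R[i]).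
Local Open Scope complex_scope.

Lemma lam_sqr : lam R ^+ 2 = 'i%C.
Proof.
rewrite /lam expr2; simpc; have e : pi / 4 *+ 2 = pi / 2 :> R by rewrite -mulr_natl; field.
apply/eqP; rewrite eq_complex /= -!expr2.
have := cos_mulr2n (pi / 4 : R); have := sin_mulr2n (pi / 4 : R).
have := cos2Dsin2 (pi / 4 : R); rewrite e sin_pihalf cos_pihalf => h1 h2 h3.
apply/andP; split; apply/eqP; move: h1 h2 h3; rewrite ?mulr2n; lra.
Qed.

Lemma lam_neq0 : lam R != 0.
Proof.
by apply/eqP => l0; have := lam_sqr; rewrite l0 expr0n => -[/esym/eqP]; rewrite oner_eq0.
Qed.

Lemma conjc_lam : (lam R)^*%C = (lam R)^-1.
Proof.
apply: (mulfI lam_neq0); rewrite divff ?lam_neq0 // /lam; simpc.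
by rewrite -!expr2 cos2Dsin2 [sin _ * _]mulrC addNr.
Qed.

(** As i - a is minus the conjugate of i + a, the left side is w minus its conjugate for w = (i + a)
    z; [cross_sub] is w plus its conjugate. *)
Lemma cross_add (a : R) z :
  ('i%C + a%:C) * z + ('i%C - a%:C) * z^*%C =
  2 * 'i%C * (complex.Re z + a * complex.Im z)%:C :> R[i].
Proof.
case: z => x y; apply/eqP; rewrite eq_complex /=.
apply/andP; split; apply/eqP; simpl; ring.
Qed.

Lemma cross_sub (a : R) z :
  ('i%C + a%:C) * z - ('i%C - a%:C) * z^*%C =
  2 * (a * complex.Re z - complex.Im z)%:C :> R[i].
Proof.
case: z => x y; apply/eqP; rewrite eq_complex /=.
apply/andP; split; apply/eqP; simpl; ring.
Qed.

Lemma conjc_lamM w : (lam R * w)^*%C = (lam R)^-1 * w^*%C.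
Proof. by rewrite -conjc_lam; exact: rmorphM. Qed.

Section MassiveShol.
Variable beta : R.
Local Notation a := (alpha beta).

Lemma i_pm_alpha_neq0 : 'i%C + a%:C != 0 :> R[i] /\ 'i%C - a%:C != 0 :> R[i].
Proof.
by split; apply/eqP => -[_ /eqP]; rewrite ?oppr0 ?addr0 oner_eq0.
Qed.

(** The fourth power of [lam] is -1, so lam^-3 = -lam; the sign turns alpha - i into i - alpha, the
    form met in [cross_add]. *)
Lemma nuE : nu beta = lam R * (('i%C + a%:C) / ('i%C - a%:C)).
Proof.
have [D1 D2] := i_pm_alpha_neq0; rewrite /nu.
have l4 : lam R ^+ 3 * lam R = -1 by rewrite -exprSr (exprM _ 2 2) lam_sqr sqr_i.
have -> : lam R ^- 3 = - lam R.
  apply: (mulfI (expf_neq0 3 (lam_neq0))).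
  by rewrite divff ?expf_neq0 ?lam_neq0 // mulrN l4 opprK.
by rewrite -(opprB _ (a%:C)) invrN mulrN mulNr mulrN opprK [a%:C + _]addrC.
Qed.

(* The two sides of each relation lie on a common real line, so that it amounts
   to a single real equation. *)
Lemma real_defect (x y c D : R[i]) (r s : R) : D != 0 -> c != 0 ->
  D * x = c * r%:C -> D * y = c * s%:C -> (x = y) <-> (r = s).
Proof.
move=> D0 c0 xr ys; split=> [xy|rs].
  by apply: complexI; apply: (mulfI c0); rewrite -xr -ys xy.
by apply: (mulfI D0); rewrite xr ys rs.
Qed.

Local Notation l := (lam R).
Local Notation v := (nu beta).
Local Notation D1 := ('i%C + a%:C : R[i]).
Local Notation D2 := ('i%C - a%:C : R[i]).

Let lk : l * l^-1 = 1. Proof. by rewrite divff ?lam_neq0. Qed.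
Let ll : l * l = 'i%C. Proof. by rewrite -expr2 lam_sqr. Qed.
Let kk : l^-1 * l^-1 = - 'i%C.
Proof.
rewrite -invfM ll; have i0 : 'i%C != 0 :> R[i] by apply/eqP => -[/eqP]; rewrite oner_eq0.
by apply: (mulfI i0); rewrite divff // mulrN mulii opprK.
Qed.
Let l3 : l ^+ 3 = 'i%C * l. Proof. by rewrite -ll; ring. Qed.
Let k3 : l ^- 3 = - 'i%C * l^-1. Proof. by rewrite -kk -exprVn; ring. Qed.
Let D2v : D2 * v = l * D1.
Proof. by rewrite nuE mulrCA [_ * (_ / _)]mulrCA divff ?mulr1 //; case: i_pm_alpha_neq0. Qed.
Let D1v : D1 * v^-1 = l^-1 * D2.
Proof.
by rewrite nuE invfM invf_div mulrCA [_ * (_ / _)]mulrCA divff ?mulr1 //; case: i_pm_alpha_neq0.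
Qed.

Let cross_addN z : D2 * z + D1 * z^*%C = 2 * 'i%C * (complex.Re z - a * complex.Im z)%:C.
Proof. by have := cross_add (- a) z; rewrite rmorphN opprK mulNr. Qed.
Let cross_subN z : D2 * z - D1 * z^*%C = - 2 * (a * complex.Re z + complex.Im z)%:C.
Proof.
have := cross_sub (- a) z; rewrite rmorphN opprK => ->.
have -> : - a * complex.Re z - complex.Im z = - (a * complex.Re z + complex.Im z) by ring.
by rewrite rmorphN mulrN mulNr.
Qed.

Let two_neq0 : 2 != 0 :> R[i]. Proof. by rewrite pnatr_eq0. Qed.
Let twoN_neq0 : - 2 != 0 :> R[i]. Proof. by rewrite oppr_eq0. Qed.
Let twoi_neq0 : 2 * 'i%C != 0 :> R[i].
Proof. by rewrite mulf_neq0 //; apply/eqP => -[/eqP]; rewrite oner_eq0. Qed.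

(** In this and the next three lemmas [D1] clears the inverse of nu, or [D2] clears nu. Both sides
    are then a common constant, 2i for north and -2 for south, times a real number, and
    [real_defect] applies. *)
Lemma shol_north_east z w :
  z + v^-1 * l * z^*%C = v^-1 * (l * w) + l * (l * w)^*%C <->
  complex.Re z + a * complex.Im z = complex.Re w - a * complex.Im w.
Proof.
apply: (real_defect (proj1 i_pm_alpha_neq0) twoi_neq0); rewrite ?conjc_lamM.
  rewrite -cross_add.
  transitivity (D1 * z + (D1 * v^-1) * l * z^*%C); first by ring.
  by rewrite D1v [l^-1 * _]mulrC -(mulrA D2) [l^-1 * _]mulrC lk mulr1.
rewrite -cross_addN.
transitivity ((D1 * v^-1) * l * w + D1 * (l * l^-1) * w^*%C); first by ring.
by rewrite D1v lk mulr1 [l^-1 * _]mulrC -(mulrA D2) [l^-1 * _]mulrC lk mulr1.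
Qed.

Lemma shol_north_west z w :
  z + v * l^-1 * z^*%C = v * (l * w) + l^-1 * (l * w)^*%C <->
  complex.Re z - a * complex.Im z = a * complex.Re w - complex.Im w.
Proof.
apply: (real_defect (proj2 i_pm_alpha_neq0) twoi_neq0); rewrite ?conjc_lamM.
  rewrite -cross_addN.
  transitivity (D2 * z + (D2 * v) * l^-1 * z^*%C); first by ring.
  by rewrite D2v [l * _]mulrC -(mulrA D1) lk mulr1.
rewrite [2 * 'i%C]mulrC -[RHS]mulrA -cross_sub.
transitivity ((D2 * v) * l * w + D2 * (l^-1 * l^-1) * w^*%C); first by ring.
rewrite D2v kk [l * _]mulrC -(mulrA D1) ll; ring.
Qed.

Lemma shol_south_east z w :
  z + v * l ^+ 3 * z^*%C = v * (l * w) + l ^+ 3 * (l * w)^*%C <->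
  a * complex.Re z + complex.Im z = complex.Re w + a * complex.Im w.
Proof.
apply: (real_defect (proj2 i_pm_alpha_neq0) twoN_neq0); rewrite ?conjc_lamM l3.
  rewrite -cross_subN.
  transitivity (D2 * z + (D2 * v) * l * 'i%C * z^*%C); first by ring.
  by rewrite D2v [l * _]mulrC -(mulrA D1) ll -(mulrA D1) mulii mulrN1 mulNr.
transitivity ('i%C * (2 * 'i%C * (complex.Re w + a * complex.Im w)%:C)); last first.
  transitivity (('i%C * 'i%C) * (2 * (complex.Re w + a * complex.Im w)%:C)); first by ring.
  by rewrite mulii mulN1r mulNr.
rewrite -cross_add.
transitivity ((D2 * v) * l * w + D2 * 'i%C * (l * l^-1) * w^*%C); first by ring.
rewrite D2v lk [l * _]mulrC -(mulrA D1) ll; ring.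
Qed.

Lemma shol_south_west z w :
  z + v^-1 * l ^- 3 * z^*%C = v^-1 * (l * w) + l ^- 3 * (l * w)^*%C <->
  complex.Im z - a * complex.Re z = a * complex.Re w + complex.Im w.
Proof.
apply: (real_defect (proj1 i_pm_alpha_neq0) twoN_neq0); rewrite ?conjc_lamM k3.
  rewrite -(opprB (a * _)) rmorphN mulrNN -cross_sub.
  transitivity (D1 * z - (D1 * v^-1) * l^-1 * 'i%C * z^*%C); first by ring.
  rewrite D1v [l^-1 * _]mulrC -(mulrA D2) kk -(mulrA D2) mulNr mulii opprK mulr1; ring.
rewrite -cross_subN.
transitivity ((D1 * v^-1) * l * w - D1 * 'i%C * (l^-1 * l^-1) * w^*%C); first by ring.
rewrite D1v kk [l^-1 * _]mulrC -(mulrA D2) [l^-1 * _]mulrC lk mulr1.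
by congr (_ - _ * _); rewrite -(mulrA D1) mulrN mulii opprK mulr1.
Qed.

End MassiveShol.
End Propagator.

Section RealLines.
Variable R : realType.

Lemma real_line_lam (w : R[i]) : real_line (lam R) (lam R * w) <-> complex.Im w = 0.
Proof.
split=> [[r]|w0].
  by rewrite mulrC => /(mulIf (lam_neq0 R)) ->.
by exists (complex.Re w); rewrite mulrC [w in LHS]complexE w0 mulr0 addr0.
Qed.

(** Since lam i = -lam^-1, the line through lam^-1 is lam times the imaginary axis. *)
Lemma real_line_lamV (w : R[i]) : real_line (lam R)^-1 (lam R * w) <-> complex.Re w = 0.
Proof.
have l0 := lam_neq0 R.
have li : lam R * 'i%C = - (lam R)^-1.
  apply: (mulfI l0).
  by rewrite mulrA -expr2 lam_sqr mulii mulrN divff.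
split=> [[r E]|w0].
  have -> : w = - r%:C%C * 'i%C.
    by apply: (mulfI l0); rewrite E mulrCA li mulrNN.
  by rewrite -rmorphN; simpc.
exists (- complex.Im w); rewrite [w in LHS]complexE w0 add0r mulrA li rmorphN mulrC.
by rewrite mulrN mulNr.
Qed.

End RealLines.

(** * Existence of the s-holomorphic extension *)

Section HalfRow.
Variables (R : realType) (n : nat) (al : R) (A B : 'I_n -> R).

Lemma half_row_exists : 1 - al ^+ 2 != 0 ->
  exists u v : 'I_n.+1 -> R,
    [/\ u ord0 = 0, v ord_max = 0,
        forall k, A k = u (rsite k) + al * v (rsite k)
      & forall k, B k = al * u (lsite k) + v (lsite k)].
Proof.
move=> al1.
(* [unlift ord0 j] is the dual site left of [j] and [insub (val j)] the one right of it. With both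
   present this is Cramer's rule with determinant 1 - al^2; at an end the boundary value 0 replaces
   the missing equation. *)
pose uv (j : 'I_n.+1) : R * R :=
  match unlift ord0 j, insub (val j) with
  | Some k, Some k' => ((A k - al * B k') / (1 - al ^+ 2), (B k' - al * A k) / (1 - al ^+ 2))
  | Some k, None => (A k, 0)
  | None, Some k' => (0, B k')
  | None, None => (0, 0)
  end.
exists (fun j => (uv j).1), (fun j => (uv j).2); split.
- by rewrite /uv unlift_none; case: insub.
- by rewrite /uv insubN ?ltnn //; case: unlift.
- move=> k; rewrite /uv /rsite liftK; case: insub => [k'|] /=; last by rewrite mulr0 addr0.
  by field.
- move=> k; rewrite /uv; have -> : insub (val (lsite k)) = Some k by exact: valK.
  case: unlift => [k'|] /=; last by rewrite mulr0 add0r.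
  by field.
Qed.

End HalfRow.

Section Extension.
Variables (R : realType) (a : int) (n : nat) (beta : R).
Hypothesis beta_gt0 : 0 < beta.
Local Notation al := (alpha beta).
Implicit Types (f g : 'M[R]_(n, 2)) (k : 'I_n) (j : 'I_n.+1).
Local Open Scope complex_scope.

Lemma half_complex : 2^-1 = (2^-1 : R)%:C :> R[i].
Proof. by rewrite fmorphV rmorph_nat. Qed.

Lemma east_edge k :
  (dual_pos R a k +i* 2^-1) + 2^-1 = (site_pos R a (rsite k) +i* 2^-1) :> R[i].
Proof.
rewrite half_complex; simpc; congr (_ +i* _); rewrite /dual_pos /site_pos /= -addrA -addrA.
by congr (_ + _); rewrite (_ : bump 0 k = k.+1) // -natr1; field.
Qed.

Lemma west_edge k :
  (dual_pos R a k +i* 2^-1) - 2^-1 = (site_pos R a (lsite k) +i* 2^-1) :> R[i].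
Proof.
by rewrite half_complex; simpc; congr (_ +i* _); rewrite /dual_pos /site_pos addrK.
Qed.

Lemma north_edge k : (dual_pos R a k +i* 2^-1) + 'i%C / 2 = (dual_pos R a k +i* 1) :> R[i].
Proof. by rewrite half_complex; simpc; congr (_ +i* _); field. Qed.

Lemma south_edge k : (dual_pos R a k +i* 2^-1) - 'i%C / 2 = (dual_pos R a k +i* 0) :> R[i].
Proof. by rewrite half_complex; simpc; congr (_ +i* _); field. Qed.

Definition side (h : R[i] -> R[i]) j : R[i] := (lam R)^-1 * h (site_pos R a j +i* 2^-1).

Lemma sideK h j : h (site_pos R a j +i* 2^-1) = lam R * side h j.
Proof. by rewrite /side mulVKf ?lam_neq0. Qed.

(** The two relations on [S] tie the half row to the row below, the two on [N] to the row above, so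
    an extension can be computed upwards. *)
Lemma massive_sholE h k (u := fun j => complex.Re (side h j)) (v := fun j => complex.Im (side h j))
    (N := h (dual_pos R a k +i* 1)) (S := h (dual_pos R a k +i* 0)) :
  massive_shol beta h (dual_pos R a k +i* 2^-1) <->
  [/\ al * complex.Re S + complex.Im S = u (rsite k) + al * v (rsite k),
      complex.Im S - al * complex.Re S = al * u (lsite k) + v (lsite k),
      complex.Re N + al * complex.Im N = u (rsite k) - al * v (rsite k)
    & complex.Re N - al * complex.Im N = al * u (lsite k) - v (lsite k)].
Proof.
rewrite /massive_shol east_edge west_edge north_edge south_edge !sideK.
split=> -[].
  move=> /shol_north_east e1 /shol_north_west e2 /shol_south_east e3 /shol_south_west e4.
  by split.
move=> e1 e2 e3 e4; split.
- exact/shol_north_east.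
- exact/shol_north_west.
- exact/shol_south_east.
- exact/shol_south_west.
Qed.

Lemma pick_inj (T : finType) (F : T -> R) (k0 : T) : injective F ->
  [pick x | F x == F k0] = Some k0.
Proof.
by move=> Finj; case: pickP => [x /eqP /Finj -> //|/(_ k0)]; rewrite eqxx.
Qed.

Lemma dual_pos_inj : injective (@dual_pos R a n).
Proof. by move=> k k' /addIr /addrI /eqP; rewrite eqr_nat => /eqP /val_inj. Qed.

Lemma site_pos_inj : injective (@site_pos R a n).
Proof. by move=> k k' /addrI /eqP; rewrite eqr_nat => /eqP /val_inj. Qed.

Lemma alpha_gt0 : 0 < al. Proof. exact: expR_gt0. Qed.

Lemma alpha_lt1 : al < 1.
Proof. by rewrite /alpha -[ltRHS]expR0 ltr_expR; move: beta_gt0; lra. Qed.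

Lemma extension_exists f : exists h, is_extension a beta f h.
Proof.
have al0 := alpha_gt0; have al1 := alpha_lt1.
have [|u [v [u0 v1 uvr uvl]]] := @half_row_exists R n al
  (fun k => al * f k ord0 + f k ord_max) (fun k => f k ord_max - al * f k ord0).
  by apply/eqP; nra.
pose X k := u (rsite k) - al * v (rsite k); pose Y k := al * u (lsite k) - v (lsite k).
(* The solution of x + al y = [X k], x - al y = [Y k]. *)
pose g k : R[i] := ((X k + Y k) / 2) +i* ((X k - Y k) / (2 * al)).
(* The imaginary part selects the row and the real part the index in it; every height other than 0
   and 1 is treated as the half row. *)
pose h (z : R[i]) : R[i] :=
  if complex.Im z == 0 then oapp (cval f) 0 [pick k | dual_pos R a k == complex.Re z]
  else if complex.Im z == 1 then oapp g 0 [pick k | dual_pos R a k == complex.Re z]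
  else oapp (fun j => lam R * (u j +i* v j)) 0 [pick j | site_pos R a j == complex.Re z].
have h0 k : h (dual_pos R a k +i* 0) = cval f k.
  by rewrite /h /= eqxx (pick_inj _ dual_pos_inj).
have h1 k : h (dual_pos R a k +i* 1) = g k.
  by rewrite /h /= oner_eq0 eqxx (pick_inj _ dual_pos_inj).
have hh j : h (site_pos R a j +i* 2^-1) = lam R * (u j +i* v j).
  by rewrite /h /= invr_eq0 pnatr_eq0 invr_eq1 pnatr_eq1 /= (pick_inj _ site_pos_inj).
have sh j : side h j = u j +i* v j by rewrite /side hh mulKf ?lam_neq0.
exists h; split => //.
- move=> k; apply/massive_sholE; rewrite h0 h1 !sh /=; split; [exact: uvr|exact: uvl| |].
    by rewrite /X /Y; field; rewrite gt_eqF.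
  by rewrite /X /Y; field; rewrite gt_eqF.
- by rewrite hh; apply/real_line_lamV.
- by rewrite hh; apply/real_line_lam.
Qed.

(** The relations hold for every extension, hence for the one behind the value picked by [xget];
    [extension_exists] ensures that there is one. *)
Lemma propagatorP f (g := propagator a beta f) : exists u v : 'I_n.+1 -> R,
  [/\ u ord0 = 0, v ord_max = 0 & forall k,
    [/\ al * f k ord0 + f k ord_max = u (rsite k) + al * v (rsite k),
        f k ord_max - al * f k ord0 = al * u (lsite k) + v (lsite k),
        g k ord0 + al * g k ord_max = u (rsite k) - al * v (rsite k)
      & g k ord0 - al * g k ord_max = al * u (lsite k) - v (lsite k)]].
Proof.
have [h0 h0_ext] := extension_exists f.
pose P := [set g0 : 'M[R]_(n, 2) | exists2 h, is_extension a beta f h &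
  forall k, cval g0 k = h (dual_pos R a k +i* 1)]%classic.
have [h [h_f h_shol h_a h_b] h_g] : P g.
  apply: xgetPex; exists (\matrix_(k, c) (if c == ord0 then complex.Re (h0 (dual_pos R a k +i* 1))
    else complex.Im (h0 (dual_pos R a k +i* 1)))).
  by exists h0 => // k; rewrite /cval !mxE /=; case: (h0 _).
exists (fun j => complex.Re (side h j)), (fun j => complex.Im (side h j)); split.
- by apply/real_line_lamV; rewrite -sideK.
- by apply/real_line_lam; rewrite -sideK.
- by move=> k; have /massive_sholE := h_shol k; rewrite -h_g h_f.
Qed.

End Extension.

(** * The isomorphism *)

Section Isomorphism.
Variables (R : realType) (n : nat).
Local Notation p := (@gen_p R n).
Local Notation q := (@gen_q R n).

Definition rho_op (Z : 'M[R[i]]_(n, 2)) : 'End({ffun config n -> (R[i])^o}) :=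
  lohi_comb p q 'i%C (fun k => Z k ord0) (fun k => Z k ord_max).

Fact rho_op_is_linear : linear rho_op.
Proof.
move=> c Z W; rewrite -lohi_comb_linear.
by apply: eq_bigr => k _; rewrite !mxE.
Qed.

HB.instance Definition _ := GRing.isLinear.Build _ _ _ _ rho_op rho_op_is_linear.

Lemma entry_gen_comb k (c d : R[i]) s t :
  entry (c *: p k + d *: q k) s t =
  (c * (spin R s (rsite k))%:C%C + d * ('i%C * (spin R s (lsite k))%:C%C))
    * (t == flip_left k s)%:R.
Proof.
etransitivity; first exact: (entry_comb _ (monomialZ c (entry_p R k) s t) (entry_q R k s t)).
by rewrite mulrDl !mulrA.
Qed.

Lemma rho_opE Z : rho_op Z =
  \sum_k ((Z k ord0 + Z k ord_max) *: p k + ('i%C * (Z k ord_max - Z k ord0)) *: q k).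
Proof. exact: lohi_combE. Qed.

Lemma flip_left_inj s : injective (fun k : 'I_n => flip_left k s).
Proof.
have le k l : flip_left k s = flip_left l s -> (k <= l)%N.
  move=> /(congr1 (fun t : config n => t (lsite k))); rewrite !ffunE leqnn /=.
  by case: leqP => // _; case: (s _).
by move=> k l kl; apply/val_inj/eqP; rewrite eqn_leq !le.
Qed.

(** Distinct dual sites send [s] to distinct configurations, so this entry sees the [k]-th term
    alone. *)
Lemma entry_rho_op Z k s : entry (rho_op Z) s (flip_left k s) =
  (Z k ord0 + Z k ord_max) * (spin R s (rsite k))%:C%C
  - (Z k ord_max - Z k ord0) * (spin R s (lsite k))%:C%C.
Proof.
rewrite rho_opE entry_sum (bigD1 k) // big1 => [|l /negPf lk].
  rewrite [LHS]addr0 entry_gen_comb eqxx mulr1 mulrACA.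
  by rewrite mulii mulN1r.
by rewrite entry_gen_comb (inj_eq (@flip_left_inj s)) eq_sym lk mulr0.
Qed.

Lemma rho_op_inj : injective rho_op.
Proof.
apply: raddf_inj => Z Z0.
have eq0 k s : (Z k ord0 + Z k ord_max) * (spin R s (rsite k))%:C%C
    - (Z k ord_max - Z k ord0) * (spin R s (lsite k))%:C%C = 0.
  by rewrite -entry_rho_op Z0 /entry lfunE ffunE.
have Z00 k : Z k ord0 = 0.
  (* With all spins up the entry is twice the first coordinate. *)
  have := eq0 k [ffun=> false]; rewrite /spin !ffunE expr0 rmorph1 !mulr1.
  by rewrite opprB addrA addrAC addrK -mulr2n => /eqP; rewrite mulrn_eq0 => /eqP.
apply/matrixP => k c; rewrite mxE; case: (unliftP ord0 c) => [c' ->|-> //].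
have -> : lift ord0 c' = ord_max by apply/val_inj; rewrite /= ord1.
(* Opposite spins next to [k] isolate twice the second coordinate. *)
have := eq0 k (flip_left k [ffun=> false]).
rewrite spin_flip_rsite spin_flip_lsite /spin !ffunE expr0 rmorphN rmorph1 Z00.
by rewrite add0r subr0 mulr1 mulrN1 opprK -mulr2n => /eqP; rewrite mulrn_eq0 => /eqP.
Qed.

Lemma rho_op_clifford Z : rho_op Z \in clifford R n.
Proof.
rewrite rho_opE; apply: rpred_sum => k _; apply: rpredD; apply: rpredZ; apply: memv_span.
  by rewrite mem_cat; apply/orP; left; apply/fintype.imageP; exists k.
by rewrite mem_cat; apply/orP; right; apply/fintype.imageP; exists k.
Qed.

Lemma clifford_sub_limg_rho_op : (clifford R n <= limg (linfun rho_op))%VS.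
Proof.
have comb_limg k (c d : R[i]) : c *: p k + d *: q k \in limg (linfun rho_op).
  rewrite -(lohi_comb_single _ _ _ _ _ (mulii R)) ?pnatr_eq0 //.
  pose Z : 'M[R[i]]_(n, 2) := \matrix_(l, j)
    if l == k then (if j == ord0 then (c + 'i%C * d) / 2 else (c - 'i%C * d) / 2) else 0.
  suff -> : lohi_comb p q 'i%C (fun l => if l == k then (c + 'i%C * d) / 2 else 0)
      (fun l => if l == k then (c - 'i%C * d) / 2 else 0) = linfun rho_op Z.
    by apply: memv_img; exact: memvf.
  by rewrite lfunE; apply: eq_bigr => l _; rewrite !mxE.
apply/span_subvP => w; rewrite mem_cat => /orP[] /fintype.imageP[k _ ->].
  by have := comb_limg k 1 0; rewrite scale1r scale0r addr0.
by have := comb_limg k 0 1; rewrite scale1r scale0r add0r.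
Qed.

End Isomorphism.

Lemma linear_bijection_onto (C : fieldType) (aT rT : vectType C) (f : {linear aT -> rT})
    (U : {vspace rT}) : injective f -> (forall x, f x \in U) -> (U <= limg (linfun f))%VS ->
  exists (g : {linear aT -> subvs_of U}) (g_inv : subvs_of U -> aT),
    [/\ cancel g g_inv, cancel g_inv g & forall x, vsval (g x) = f x].
Proof.
move=> f_inj fU U_limg.
have f0 : lker (linfun f) == 0%VS by apply/lker0P => x y; rewrite !lfunE => /f_inj.
exists (vsproj U \o f : {linear _ -> _}), (fun w => (linfun f)^-1%VF (vsval w)); split.
- by move=> x /=; rewrite vsprojK // -[f x](lfunE f) lker0_lfunK.
- move=> w; apply/val_inj; rewrite /= vsprojK ?fU // -[LHS](lfunE f).
  by rewrite limg_lfunVK // (subvP U_limg) // subvsP.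
- by move=> x /=; rewrite vsprojK.
Qed.

(** * The intertwining relation and the conclusion *)

Section Transfer.
Variables (R : realType) (a : int) (m : nat) (beta : R).
Hypothesis beta_gt0 : 0 < beta.
Local Open Scope complex_scope.

Lemma intertwines_rho_op (Z : 'M[R[i]]_(m.+1, 2)) :
  intertwines (transfer m.+1 beta) (rho_op Z)
    (rho_op (complexify (propagator a beta) Z)).
Proof.
have [u [v [u0 v1 relr]]] := propagatorP a beta_gt0 (map_mx (@complex.Re R) Z).
have [u' [v' [u'0 v'1 reli]]] := propagatorP a beta_gt0 (map_mx (@complex.Im R) Z).
(* The unit here belongs to the complexification, not to the identification of the plane with the
   complex numbers: [u] and [v] each become complex, and the relations persist because they are
   linear with real coefficients. *)
pose cplx (x y : 'I_m.+2 -> R) j : R[i] := (x j)%:C + 'i%C * (y j)%:C.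
apply: (@intertwines_transfer _ _ m _ _ _ _ 'i%C (alpha beta)%:C (expR (- beta))%:C
  (expR beta)%:C _ _ _ _ _ _ _ _ _ _ _ (cplx u u') (cplx v v')).
- by rewrite -rmorphM -expRD addrN expR0.
- by rewrite -rmorphM /alpha -expRD; congr (expR _)%:C; ring.
- exact: Vh_half_lo.
- exact: Vh_half_hi.
- by move=> k l x y kl; exact: Vv_interior.
- exact: Vv_last.
- exact: Vv_first.
- by rewrite /cplx u0 u'0 mulr0 addr0.
- by rewrite /cplx v1 v'1 mulr0 addr0.
move=> k; have [r1 r2 r3 r4] := relr k; have [i1 i2 i3 i4] := reli k.
move: r1 r2 i1 i2; rewrite !mxE => r1 r2 i1 i2.
have cplx_eq (s t s' t' : R) : s = t -> s' = t' ->
    s%:C + 'i%C * s'%:C = t%:C + 'i%C * t'%:C by move=> -> ->.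
rewrite /cplx [Z k ord0]complexE [Z k ord_max]complexE.
split.
- apply: etrans (etrans (cplx_eq _ _ _ _ r1 i1) _); ring.
- apply: etrans (etrans (cplx_eq _ _ _ _ r2 i2) _); ring.
- apply: etrans (etrans (cplx_eq _ _ _ _ r3 i3) _); ring.
- apply: etrans (etrans (cplx_eq _ _ _ _ r4 i4) _); ring.
Qed.

End Transfer.

Theorem theorem10 (R : realType) (a b : int) (hab : a < b)
    (beta : R) (hbeta : 0 < beta) :
  exists (rho : {linear 'M[R[i]]_(width a b, 2) -> subvs_of (clifford R (width a b))})
         (rho_inv : subvs_of (clifford R (width a b)) -> 'M[R[i]]_(width a b, 2)),
    [/\ cancel rho rho_inv, cancel rho_inv rho
      & forall w : subvs_of (clifford R (width a b)),
          rotation (transfer (width a b) beta) (vsval w)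
          = vsval (rho (complexify (propagator a beta) (rho_inv w)))].
Proof.
(* As a < b there is at least one dual site, so the first and the last one exist. *)
have [m ->] : exists m, width a b = m.+1.
  by exists (width a b).-1; rewrite prednK // absz_gt0 subr_eq0 gt_eqF.
have [rho [rho_inv [rhoK rho_invK rhoE]]] := linear_bijection_onto
  (@rho_op_inj R m.+1) (@rho_op_clifford R m.+1) (@clifford_sub_limg_rho_op R m.+1).
exists rho, rho_inv; split => // w; rewrite -{1}[w]rho_invK !rhoE.
apply: lker0_conj (intertwines_rho_op a hbeta (rho_inv w)).
exact: transfer_lker0.
Qed.
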